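(* Let $r\ge1$, let $\boldsymbol{\mu}=(\mu_1,\dots,\mu_r)$ be a system of (possibly complex) measures on $\mathbb{R}$ with all moments finite, let $j,\ell\in\{1,\dots,r\}$, and let $\boldsymbol{n}\in\mathbb{N}^r$ with $n_j\ge2$ and $n_\ell\ge1$. Assume that $\boldsymbol{n}$, $\boldsymbol{n}-\boldsymbol{e}_j$ and $\boldsymbol{n}-\boldsymbol{e}_\ell$ are normal for $\boldsymbol{\mu}$. For $z_0\in\mathbb{C}$ let $\boldsymbol{\mu}_{z_0}$ be the system obtained from $\boldsymbol{\mu}$ by replacing $\mu_j$ with $(x-z_0)^2\mu_j$ and leaving all other measures unchanged (for $j=1$: $((x-z_0)^2\mu_1,\mu_2,\dots,\mu_r)$). Let $A^{(j)}_{\boldsymbol{n}}$ and $A^{(j)}_{\boldsymbol{n}-\boldsymbol{e}_\ell}$ be the $j$-th components of the type I multiple orthogonal polynomials of $\boldsymbol{\mu}$ at $\boldsymbol{n}$ and $\boldsymbol{n}-\boldsymbol{e}_\ell$, and let $W=A^{(j)}_{\boldsymbol{n}}\big(A^{(j)}_{\boldsymbol{n}-\boldsymbol{e}_\ell}\big)'-\big(A^{(j)}_{\boldsymbol{n}}\big)'A^{(j)}_{\boldsymbol{n}-\boldsymbol{e}_\ell}$ be their Wronskian. Then $$\{z_0\in\mathbb{C}:W(z_0)=0\}=\{z_0\in\mathbb{C}:\boldsymbol{n}-2\boldsymbol{e}_j\text{ is not normal for }\boldsymbol{\mu}_{z_0}\}.$$ Moreover, if $A^{(j)}_{\boldsymbol{n}}$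 and $A^{(j)}_{\boldsymbol{n}-\boldsymbol{e}_\ell}$ have real coefficients and $A^{(j)}_{\boldsymbol{n}}$ is real-rooted, then the zeros of $A^{(j)}_{\boldsymbol{n}}$ and $A^{(j)}_{\boldsymbol{n}-\boldsymbol{e}_\ell}$ interlace if and only if $\boldsymbol{n}-2\boldsymbol{e}_j$ is normal for $\boldsymbol{\mu}_{z_0}$ for every $z_0\in\mathbb{R}$.
   Context: $\mathbb{N}=\{0,1,2,\dots\}$; $|\boldsymbol{n}|=n_1+\dots+n_r$; $\boldsymbol{e}_j$ is the $j$-th standard unit vector. For a system $\boldsymbol{\mu}=(\mu_1,\dots,\mu_r)$ of (possibly complex) measures on $\mathbb{R}$ with finite moments, an index $\boldsymbol{n}\in\mathbb{N}^r$ is normal if there is a unique monic polynomial $P_{\boldsymbol{n}}$ of exact degree $|\boldsymbol{n}|$ with $\int P_{\boldsymbol{n}}(x)x^k\,d\mu_i(x)=0$ for $k=0,\dots,n_i-1$, $i=1,\dots,r$. Equivalently, the $|\boldsymbol{n}|\times|\boldsymbol{n}|$ matrix obtained by stacking, for $i=1,\dots,r$, the blocks $\big(\int x^{p+q}d\mu_i(x)\big)_{0\le p\le n_i-1,\,0\le q\le|\boldsymbol{n}|-1}$ has non-zero determinant (the empty determinant being $1$). For $\boldsymbol{n}\ne\boldsymbol{0}$ this is also equivalent to existence and uniqueness of the type I multiple orthogonal polynomial at $\boldsymbol{n}$: a non-zero vector of polynomials $(A^{(1)}_{\boldsymbol{n}},\dots,A^{(r)}_{\boldsymbol{n}})$ with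 $\deg A^{(i)}_{\boldsymbol{n}}\le n_i-1$ (so $A^{(i)}_{\boldsymbol{n}}=0$ if $n_i=0$) and $\sum_{i=1}^r\int A^{(i)}_{\boldsymbol{n}}(x)x^k\,d\mu_i(x)$ equal to $0$ for $k=0,\dots,|\boldsymbol{n}|-2$ and to $1$ for $k=|\boldsymbol{n}|-1$. $(x-z_0)^2\mu$ denotes the measure $\nu$ with $\int f\,d\nu=\int f(x)(x-z_0)^2\,d\mu(x)$. A polynomial is real-rooted if all its complex zeros are real. The zeros of two real polynomials $p,q$ interlace if all zeros of $p$ and of $q$ are real and simple, $p$ and $q$ have no common zero, and between every two consecutive zeros of either one of the polynomials there lies exactly one zero of the other (the zero polynomial does not interlace with any polynomial). *)

(* Defs.v *)
From HB Require Import structures.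
From mathcomp Require Import all_boot all_order all_algebra.
From mathcomp Require Import all_classical all_reals all_analysis.
From mathcomp Require Import complex.

Set Implicit Arguments.
Unset Strict Implicit.
Unset Printing Implicit Defensive.

Import Order.TTheory GRing.Theory Num.Theory.
Import numFieldNormedType.Exports.

Local Open Scope classical_set_scope.
Local Open Scope ring_scope.
Local Open Scope complex_scope.

Section RealCharges.
Context {R : realType}.
Local Notation charge := ({charge set (measurableTypeR R) -> \bar R})%type.
Implicit Types (c : charge) (f : R -> R).

Definition hahn_pos c : set R := sval (cid (Hahn_decomposition c)).

Definition hahn_neg c : set R := sval (cid (svalP (cid (Hahn_decomposition c)))).

Lemma hahnP c : hahn_decomposition c (hahn_pos c) (hahn_neg c).
Proof. exact: (svalP (cid (svalP (cid (Hahn_decomposition c))))). Qed.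

Definition charge_pos c : {finite_measure set (measurableTypeR R) -> \bar R} :=
  jordan_pos (hahnP c).

Definition charge_neg c : {finite_measure set (measurableTypeR R) -> \bar R} :=
  jordan_neg (hahnP c).

Definition charge_integrable c f : Prop :=
  (charge_pos c).-integrable setT (EFin \o f) /\
  (charge_neg c).-integrable setT (EFin \o f).

Definition charge_integral c f : R :=
  Rintegral (charge_pos c) setT f - Rintegral (charge_neg c) setT f.

(* The charge [A |-> \int_A f dc]; the junk value [czero] is only used when
   [f] is not integrable for [c]. *)
Definition charge_density f c : charge :=
  match pselect (charge_integrable c f) with
  | left fc => cadd (induced_charge fc.1) (copp (induced_charge fc.2))
  | right _ => czero
  end.

End RealCharges.

(* A complex measure on the Borel sets of the real line, given by its real and
   imaginary parts.  A positive measure with finite moments is finite, hence is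
   of this form. *)
Record complex_measure (R : realType) := ComplexMeasure {
  re_part : {charge set (measurableTypeR R) -> \bar R};
  im_part : {charge set (measurableTypeR R) -> \bar R} }.

Section ComplexMeasures.
Context {R : realType}.
Implicit Types (mu : complex_measure R) (f : R -> R[i]).

Definition finite_moments mu : Prop :=
  forall k : nat, charge_integrable (re_part mu) (fun x => x ^+ k) /\
                  charge_integrable (im_part mu) (fun x => x ^+ k).

Definition cintegral mu f : R[i] :=
  let u x := complex.Re (f x) in let v x := complex.Im (f x) in
  (charge_integral (re_part mu) u - charge_integral (im_part mu) v)
  +i* (charge_integral (re_part mu) v + charge_integral (im_part mu) u).

(* The complex measure [f mu]: its real part is [Re f . Re mu - Im f . Im mu]
   and its imaginary part is [Im f . Re mu + Re f . Im mu]. *)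
Definition cdensity f mu : complex_measure R :=
  let u x := complex.Re (f x) in let v x := complex.Im (f x) in
  ComplexMeasure
    (cadd (charge_density u (re_part mu)) (copp (charge_density v (im_part mu))))
    (cadd (charge_density v (re_part mu)) (charge_density u (im_part mu))).

(* \int p(x) dmu(x) *)
Definition poly_integral mu (p : {poly R[i]}) : R[i] :=
  cintegral mu (fun x => p.[x%:C]).

End ComplexMeasures.

Section MultipleOrthogonality.
Context {R : realType} {r : nat}.
Implicit Types (mu : 'I_r -> complex_measure R) (n : 'I_r -> nat).

Definition msum n : nat := (\sum_(i < r) n i)%N.

(* [n - m e_j]; the subtraction is truncated, so this is meaningful only when
   [m <= n j]. *)
Definition msub n (m : nat) (j : 'I_r) : 'I_r -> nat :=
  fun i => if i == j then (n i - m)%N else n i.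

Definition type_II mu n (P : {poly R[i]}) : Prop :=
  [/\ P \is monic, size P = (msum n).+1 &
      forall (i : 'I_r) (k : nat), (k < n i)%N ->
        poly_integral (mu i) (P * 'X^k) = 0].

Definition normal mu n : Prop := exists! P : {poly R[i]}, type_II mu n P.

Definition type_I mu n (A : 'I_r -> {poly R[i]}) : Prop :=
  [/\ exists i, A i != 0,
      forall i, (size (A i) <= n i)%N,
      forall k : nat, (k.+1 < msum n)%N ->
        \sum_(i < r) poly_integral (mu i) (A i * 'X^k) = 0 &
      forall k : nat, k.+1 = msum n ->
        \sum_(i < r) poly_integral (mu i) (A i * 'X^k) = 1].

Definition transform mu (j : 'I_r) (z0 : R[i]) : 'I_r -> complex_measure R :=
  fun i => if i == j then cdensity (fun x => (x%:C - z0) ^+ 2) (mu i) else mu i.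

End MultipleOrthogonality.

Section Polynomials.
Context {R : realType}.
Implicit Types p q : {poly R[i]}.

Definition wronskian p q : {poly R[i]} := p * q^`() - p^`() * q.

Definition real_coefs p : Prop := p \is a polyOver Num.real.

Definition real_rooted p : Prop := forall z : R[i], root p z -> z \is Num.real.

Definition simple_zeros p : Prop := forall z : R[i], root p z -> mup z p = 1%N.

(* Exactly one zero of [q] lies strictly between any two consecutive real zeros
   of [p]. *)
Definition separated_by p q : Prop :=
  forall a b : R, a < b -> root p a%:C -> root p b%:C ->
    (forall c : R, a < c < b -> ~~ root p c%:C) ->
    exists! c : R, a < c < b /\ root q c%:C.

Definition interlace p q : Prop :=
  [/\ p != 0 /\ q != 0,
      real_rooted p /\ simple_zeros p,
      real_rooted q /\ simple_zeros q,
      forall z : R[i], ~~ (root p z && root q z) &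
      separated_by p q /\ separated_by q p].

End Polynomials.

(* Main.v *)
Require Import Defs.
From HB Require Import structures.
From mathcomp Require Import all_boot all_order all_algebra.
From mathcomp Require Import all_classical all_reals all_analysis.
From mathcomp Require Import measurable_realfun complex polyrcf ring lra zify.

(** A vector [C] with [deg C_i < n_i] that is orthogonal to [x^k] for
    [k < |n| - 2] is a combination of the type I vectors [A] at [n] and [B] at
    [n - e_l].  Dividing the [j]-th component by [(x - z0)^2] turns such vectors
    with a double zero of [C_j] at [z0] into the vectors that witness the
    degeneracy of [n - 2 e_j] for the transformed system, and [a A_j + b B_j]
    has a double zero at [z0] for some [(a, b) <> 0] iff the Wronskian vanishes.

    For the interlacing, write [p = A_j], [q = B_j], let [a] range over the
    zeros of [p], [p_a = p / (x - a)] and [c_a = q(a) / p'(a)].  Partial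
    fractions give
      [q(z) p(w) - q(w) p(z) = (w - z) \sum_a c_a p_a(z) p_a(w)].
    If all [c_a] have the same sign, [w = conj z] shows that [q] is real-rooted
    and [w -> z] that the Wronskian has no real zero.  The common sign follows
    both from interlacing and from a Wronskian without real zeros. *)

Set Implicit Arguments.
Unset Strict Implicit.
Unset Printing Implicit Defensive.

Import Order.TTheory GRing.Theory Num.Theory.
Local Open Scope classical_set_scope.
Local Open Scope ring_scope.
Local Open Scope complex_scope.

(* [measure_function.msum] hides the [msum] of [Defs]. *)
Local Notation msum := Defs.msum.

(** * Densities and differences of finite measures *)

Section FiniteMeasures.
Context d (T : measurableType d) (R : realType).
Implicit Types (mu nu : {finite_measure set T -> \bar R}) (f u : T -> R).
Local Open Scope ereal_scope.

Lemma le_measure_integrable mu nu f :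
  (forall A, measurable A -> mu A <= nu A) ->
  nu.-integrable setT (EFin \o f) -> mu.-integrable setT (EFin \o f).
Proof.
move=> le_mu_nu /integrableP[mf ifin]; apply/integrableP; split=> //.
apply: le_lt_trans ifin.
apply: ge0_le_measure_integral => //; exact: measurableT_comp mf.
Qed.

(** The third hypothesis makes [nu] absolutely continuous, and since a density is determined by its
    integrals, [u] agrees almost everywhere with the Radon-Nikodym derivative. The claim is then its
    change of variables formula. *)
Lemma ge0_integral_density mu nu u :
  (forall x, (0 <= u x)%R) -> mu.-integrable setT (EFin \o u) ->
  (forall A, measurable A -> nu A = \int[mu]_(x in A) (u x)%:E) ->
  forall f, (forall x, (0 <= f x)%R) -> measurable_fun setT f ->
  \int[nu]_x (f x)%:E = \int[mu]_x (f x * u x)%:E.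
Proof.
move=> u0 iu nuE f f0 mf.
have numu : nu `<< mu.
  apply/null_content_dominatesP => A mA muA; rewrite nuE//.
  apply: null_set_integral => //; apply: measurable_funTS; exact: measurable_int iu.
have mu_u : measurable_fun setT (EFin \o u) by exact: measurable_int iu.
rewrite -(Radon_Nikodym_SigmaFinite.change_of_variables numu)// ?lee_fin//; last first.
  exact/measurable_EFinP.
have RNi := Radon_Nikodym_SigmaFinite.f_integrable numu.
apply: ge0_ae_eq_integral => //.
- by apply: emeasurable_funM; [exact/measurable_EFinP|exact: measurable_int RNi].
- by apply/measurable_EFinP/measurable_funM => //; exact/measurable_EFinP.
- by move=> x _; rewrite mule_ge0 ?lee_fin// Radon_Nikodym_SigmaFinite.f_ge0.
- by move=> x _; rewrite lee_fin mulr_ge0.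
have : ae_eq mu setT (Radon_Nikodym_SigmaFinite.f nu mu) (EFin \o u).
  apply: integral_ae_eq => // A _ mA.
  by rewrite -Radon_Nikodym_SigmaFinite.f_integral// nuE.
by apply: filterS => x /= /(_ I) ->.
Qed.

(** As [u] is non-negative, the positive and negative parts of [f * u] are those of [f] times [u],
    which reduces the claim to the non-negative case. *)
Lemma integral_density mu nu u :
  (forall x, (0 <= u x)%R) -> mu.-integrable setT (EFin \o u) ->
  (forall A, measurable A -> nu A = \int[mu]_(x in A) (u x)%:E) ->
  forall f, measurable_fun setT f ->
  mu.-integrable setT (EFin \o (f \* u)%R) ->
  nu.-integrable setT (EFin \o f) /\
  Rintegral nu setT f = Rintegral mu setT (f \* u)%R.
Proof.
move=> u0 iu nuE f mf ifu.
have H := ge0_integral_density u0 iu nuE.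
have i_f : nu.-integrable setT (EFin \o f).
  apply/integrableP; split; first exact/measurable_EFinP.
  under eq_integral do rewrite /=.
  rewrite H//; last exact: measurableT_comp.
  move/integrableP: ifu => [_]; congr (_ < _).
  by apply: eq_integral => x _ /=; rewrite normrM (ger0_norm (u0 x)).
have pos (g : T -> R) : measurable_fun setT g ->
    \int[nu]_x (EFin \o g)^\+ x = \int[mu]_x (EFin \o (g \* u)%R)^\+ x.
  move=> mg; transitivity (\int[nu]_x ((fun x => Num.max (g x) 0%R) x)%:E).
    by apply: eq_integral => x _; rewrite funeposE EFin_max.
  rewrite H//; last exact: measurable_maxr.
  apply: eq_integral => x _; rewrite funeposE /= -EFin_max.
    by rewrite maxr_pMl// mul0r.
  by move=> x; rewrite le_max lexx orbT.
have neg (rho : {measure set T -> \bar R}) (g : T -> R) :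
    \int[rho]_x (EFin \o g)^\- x = \int[rho]_x (EFin \o (\- g)%R)^\+ x.
  by apply: eq_integral => x _; rewrite funenegE funeposE /= EFinN.
split=> //; congr fine.
rewrite integralE [RHS]integralE; congr (_ - _); first exact: pos.
rewrite [LHS]neg [RHS]neg pos; last exact: measurableT_comp.
by apply: eq_integral => x _; rewrite !funeposE /= mulNr.
Qed.

Lemma measure_add_integrable mu nu f :
  mu.-integrable setT (EFin \o f) -> nu.-integrable setT (EFin \o f) ->
  (measure_add mu nu).-integrable setT (EFin \o f).
Proof.
move=> /integrableP[mf i1] /integrableP[_ i2]; apply/integrableP; split=> //.
rewrite ge0_integral_measure_add//; last exact: measurableT_comp mf.
by rewrite lte_add_pinfty.
Qed.

Lemma Rintegral_measure_add mu nu f :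
  mu.-integrable setT (EFin \o f) -> nu.-integrable setT (EFin \o f) ->
  (Rintegral (measure_add mu nu) setT f =
   Rintegral mu setT f + Rintegral nu setT f)%R.
Proof.
move=> i1 i2; rewrite /Rintegral integral_measure_add// fineD//.
all: exact: integrable_fin_num.
Qed.

Lemma sube_eq_adde (a b p q : \bar R) :
  a \is a fin_num -> b \is a fin_num -> p \is a fin_num -> q \is a fin_num ->
  a - b = p - q -> a + q = p + b.
Proof.
move: a b p q => [a||] [b||] [p||] [q||] //= _ _ _ _ [H].
by rewrite -!EFinD; congr EFin; lra.
Qed.

(** Moving the negative terms across turns the hypothesis into the equality of the measures
    [mu1 + nu2] and [nu1 + mu2]. *)
Lemma eq_Rintegral_diff mu1 mu2 nu1 nu2 f :
  (forall A, measurable A -> mu1 A - mu2 A = nu1 A - nu2 A) ->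
  mu1.-integrable setT (EFin \o f) -> mu2.-integrable setT (EFin \o f) ->
  nu1.-integrable setT (EFin \o f) -> nu2.-integrable setT (EFin \o f) ->
  (Rintegral mu1 setT f - Rintegral mu2 setT f =
   Rintegral nu1 setT f - Rintegral nu2 setT f)%R.
Proof.
move=> eqA i1 i2 j1 j2.
suff : (Rintegral (measure_add mu1 nu2) setT f =
        Rintegral (measure_add nu1 mu2) setT f)%R.
  by rewrite !Rintegral_measure_add// => H; lra.
congr fine; apply: eq_measure_integral => A mA _.
rewrite [LHS]measure_addE [RHS]measure_addE.
by apply: sube_eq_adde; rewrite ?fin_num_measure// eqA.
Qed.

Lemma fin_num_measure_add mu nu : fin_num_fun (measure_add mu nu).
Proof.
by move=> A mA; rewrite measure_addE fin_numD !fin_num_measure.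
Qed.

HB.instance Definition _ mu nu := Measure.on (measure_add mu nu).
HB.instance Definition _ mu nu :=
  @Measure_isFinite.Build _ _ _ (measure_add mu nu)
    (@fin_num_measure_add mu nu).

Section PositiveDensity.
Variables (mu : {finite_measure set T -> \bar R}) (u : T -> R).
Hypotheses (u0 : forall x, (0 <= u x)%R) (iu : mu.-integrable setT (EFin \o u)).

Let induced_ge0 A : 0 <= induced_charge iu A.
Proof. by apply: integral_ge0 => x _; rewrite lee_fin. Qed.

(** The induced charge repackaged as a finite measure, so that [integral_density] applies to it. *)
Definition density_measure := measure_of_charge _ induced_ge0.

HB.instance Definition _ := Measure.on density_measure.

Let fin_num_density_measure : fin_num_fun density_measure.
Proof. by move=> A mA; rewrite fin_num_measure. Qed.

HB.instance Definition _ := @Measure_isFinite.Build _ _ _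
  density_measure fin_num_density_measure.

End PositiveDensity.

(** The two measures have the positive and the negative part of [u] as densities; both parts are
    dominated by [|u|], whence all integrability claims. *)
Lemma induced_chargeB mu u (iu : mu.-integrable setT (EFin \o u)) f :
  measurable_fun setT f -> mu.-integrable setT (EFin \o (f \* u)%R) ->
  exists nu1 nu2 : {finite_measure set T -> \bar R},
    (forall A, measurable A -> induced_charge iu A = nu1 A - nu2 A) /\
    [/\ nu1.-integrable setT (EFin \o f), nu2.-integrable setT (EFin \o f) &
      (Rintegral nu1 setT f - Rintegral nu2 setT f =
       Rintegral mu setT (f \* u))%R].
Proof.
move=> mf ifu.
have m_u : measurable_fun setT u.
  by apply/measurable_EFinP; exact: measurable_int iu.
pose up x := Num.max (u x) 0%R; pose un x := Num.max (- u x)%R 0%R.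
have mup : measurable_fun setT up by exact: measurable_maxr.
have mun : measurable_fun setT un.
  by apply: measurable_maxr => //; exact: measurableT_comp.
have up0 x : (0 <= up x)%R by rewrite le_max lexx orbT.
have un0 x : (0 <= un x)%R by rewrite le_max lexx orbT.
have uE x : (u x = up x - un x)%R by rewrite /up /un /Num.max; do 2!case: ifP; lra.
have upu x : (`|up x| <= `|u x|)%R.
  by rewrite ger0_norm// ge_max normr_ge0 ler_norm.
have unu x : (`|un x| <= `|u x|)%R.
  by rewrite ger0_norm// ge_max normr_ge0 -normrN ler_norm.
have iup : mu.-integrable setT (EFin \o up).
  apply: le_integrable iu => //; first exact/measurable_EFinP.
  by move=> x _; rewrite /= lee_fin.
have iun : mu.-integrable setT (EFin \o un).
  apply: le_integrable iu => //; first exact/measurable_EFinP.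
  by move=> x _; rewrite /= lee_fin.
have dom (v : T -> R) : measurable_fun setT v -> (forall x, `|v x| <= `|u x|)%R ->
    mu.-integrable setT (EFin \o (f \* v)%R).
  move=> mv vu; apply: le_integrable ifu => //.
    by apply/measurable_EFinP; exact: measurable_funM.
  by move=> x _; rewrite /= lee_fin !normrM ler_wpM2l.
have ifup := dom _ mup upu.
have ifun := dom _ mun unu.
have [jp Ep] := integral_density up0 iup
  (nu := density_measure up0 iup) (fun _ _ => erefl) mf ifup.
have [jn En] := integral_density un0 iun
  (nu := density_measure un0 iun) (fun _ _ => erefl) mf ifun.
exists (density_measure up0 iup), (density_measure un0 iun); split; last first.
  split=> //; rewrite Ep En -RintegralB//.
  by apply: eq_Rintegral => x _; rewrite /= uE mulrBr.
move=> A mA; rewrite /induced_charge -[RHS]/(\int[mu]_(x in A) (up x)%:E -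
  \int[mu]_(x in A) (un x)%:E) -integralB//.
- by apply: eq_integral => x _; rewrite /= uE EFinB.
- exact: (integrableS measurableT mA (@subsetT _ A) iup).
- exact: (integrableS measurableT mA (@subsetT _ A) iun).
Qed.

End FiniteMeasures.

(** * Integration against charges *)

Section ChargeIntegrals.
Context {R : realType}.
Local Notation T := (measurableTypeR R).
Implicit Types (c : {charge set T -> \bar R}) (f u : R -> R).
Implicit Types (mu nu : {finite_measure set T -> \bar R}).

Let charge_posD_charge_neg c A : measurable A ->
  c A = (charge_pos c A - charge_neg c A)%E.
Proof.
move=> mA; rewrite (jordan_decomp (hahnP c) mA).
by rewrite /cadd /= cscaleN1.
Qed.

Let charge_posE c A : measurable A -> charge_pos c A = c (A `&` hahn_pos c).
Proof.
by move=> mA; rewrite [LHS](jordan_posE (hahnP c)) cjordan_posE /crestr0 mem_set.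
Qed.

Let charge_negE c A : measurable A ->
  (charge_neg c A = - c (A `&` hahn_neg c))%E.
Proof.
by move=> mA; rewrite [LHS](jordan_negE (hahnP c)) cjordan_negE /crestr0 mem_set.
Qed.

(** Minimality of the Jordan decomposition: the positive part of [c] is [c] restricted to the
    positive Hahn set, where it is at most [nu1]. *)
Lemma charge_pos_le c nu1 nu2 :
  (forall A, measurable A -> c A = nu1 A - nu2 A)%E ->
  forall A, measurable A -> (charge_pos c A <= nu1 A)%E.
Proof.
move=> cE A mA.
have mAP : measurable (A `&` hahn_pos c).
  by apply: measurableI => //; case: (hahnP c) => -[].
rewrite charge_posE// cE//; apply: (@le_trans _ _ (nu1 (A `&` hahn_pos c))).
  by rewrite leeBlDr ?fin_num_measure// leeDl.
by apply: le_measure; rewrite ?inE//; exact: subIsetl.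
Qed.

Lemma charge_neg_le c nu1 nu2 :
  (forall A, measurable A -> c A = nu1 A - nu2 A)%E ->
  forall A, measurable A -> (charge_neg c A <= nu2 A)%E.
Proof.
move=> cE A mA.
have mAN : measurable (A `&` hahn_neg c).
  by apply: measurableI => //; case: (hahnP c) => _ [].
rewrite charge_negE// cE// fin_num_oppeB ?fin_num_measure//.
apply: (@le_trans _ _ (nu2 (A `&` hahn_neg c))).
  by rewrite addeC leeBlDr ?fin_num_measure// leeDl.
by apply: le_measure; rewrite ?inE//; exact: subIsetl.
Qed.

(** Frees integration from the chosen Hahn decomposition: any representation of [c] as a difference
    of finite measures computes the integral. Sums, opposites and densities of charges are all
    treated through such a representation. *)
Lemma charge_integral_diff c nu1 nu2 f :
  (forall A, measurable A -> c A = nu1 A - nu2 A)%E ->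
  nu1.-integrable setT (EFin \o f) -> nu2.-integrable setT (EFin \o f) ->
  charge_integrable c f /\
  charge_integral c f = Rintegral nu1 setT f - Rintegral nu2 setT f.
Proof.
move=> cE i1 i2.
have ip := le_measure_integrable (charge_pos_le cE) i1.
have ine := le_measure_integrable (charge_neg_le cE) i2.
split=> //; apply: eq_Rintegral_diff => // A mA.
by rewrite -charge_posD_charge_neg// cE.
Qed.

Lemma charge_integral_cadd c1 c2 f :
  charge_integrable c1 f -> charge_integrable c2 f ->
  charge_integrable (cadd c1 c2) f /\
  charge_integral (cadd c1 c2) f = charge_integral c1 f + charge_integral c2 f.
Proof.
move=> [p1 n1] [p2 n2].
have [|||H1 H2] := @charge_integral_diff (cadd c1 c2)
  (measure_add (charge_pos c1) (charge_pos c2))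
  (measure_add (charge_neg c1) (charge_neg c2)) f.
- move=> A mA.
  have addE (m m' : {finite_measure set T -> \bar R}) := measure_addE m m' A.
  apply: etrans (esym (congr2 (fun a b => a - b)%E (addE _ _) (addE _ _))).
  rewrite fin_num_oppeD ?fin_num_measure// addeACA.
  by rewrite -!charge_posD_charge_neg.
- exact: measure_add_integrable.
- exact: measure_add_integrable.
split=> //; rewrite H2 !Rintegral_measure_add// /charge_integral; lra.
Qed.

Lemma charge_integral_copp c f : charge_integrable c f ->
  charge_integrable (copp c) f /\
  charge_integral (copp c) f = - charge_integral c f.
Proof.
move=> [ip ine].
have [|H1 H2] := @charge_integral_diff (copp c) _ _ f _ ine ip.
  move=> A mA; rewrite -[LHS]/(- c A)%E charge_posD_charge_neg//.
  by rewrite fin_num_oppeB ?fin_num_measure// addeC.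
by split=> //; rewrite H2 /charge_integral opprB.
Qed.

Lemma charge_integral_induced mu u (iu : mu.-integrable setT (EFin \o u)) f :
  measurable_fun setT f ->
  mu.-integrable setT (EFin \o (f \* u)) ->
  charge_integrable (induced_charge iu) f /\
  charge_integral (induced_charge iu) f = Rintegral mu setT (f \* u).
Proof.
move=> mf ifu.
have [nu1 [nu2 [cE [i1 i2 <-]]]] := induced_chargeB iu mf ifu.
exact: charge_integral_diff.
Qed.

(** Integrability of [u] selects the proper branch of [charge_density]; there the density is taken
    on each Jordan part of [c] separately. *)
Lemma charge_integral_density c u f :
  measurable_fun setT f -> charge_integrable c u ->
  charge_integrable c (f \* u) ->
  charge_integrable (charge_density u c) f /\
  charge_integral (charge_density u c) f = charge_integral c (f \* u).
Proof.
move=> mf cu cfu; rewrite /charge_density; case: pselect => // ic.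
have [Hp1 Hp2] := charge_integral_induced (proj1 ic) mf cfu.1.
have [Hn1 Hn2] := charge_integral_induced (proj2 ic) mf cfu.2.
have [Ho1 Ho2] := charge_integral_copp Hn1.
have [H1 H2] := charge_integral_cadd Hp1 Ho1.
by split=> //; rewrite H2 Ho2 Hp2 Hn2.
Qed.

Lemma charge_integralD c f u :
  charge_integrable c f -> charge_integrable c u ->
  charge_integrable c (fun x => f x + u x) /\
  charge_integral c (fun x => f x + u x) =
    charge_integral c f + charge_integral c u.
Proof.
move=> [fp fn] [up un]; split; first split.
- exact: (integrableD measurableT fp up).
- exact: (integrableD measurableT fn un).
- by rewrite /charge_integral (RintegralD _ fp up)// (RintegralD _ fn un)//; ring.
Qed.

Lemma charge_integralZ c (a : R) f : charge_integrable c f ->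
  charge_integrable c (fun x => a * f x) /\
  charge_integral c (fun x => a * f x) = a * charge_integral c f.
Proof.
move=> [fp fn]; split; first split.
- exact: (integrableZl measurableT a fp).
- exact: (integrableZl measurableT a fn).
- by rewrite /charge_integral (RintegralZl _ _ fp)// (RintegralZl _ _ fn)//; ring.
Qed.

End ChargeIntegrals.

(** * Integrals of complex polynomials against complex measures *)

Section PolynomialIntegrals.
Context {R : realType}.
Local Notation charge := ({charge set (measurableTypeR R) -> \bar R}).
Implicit Types (c : charge) (u v w : {poly R}) (p q : {poly R[i]}).
Implicit Type mu : complex_measure R.

Definition charge_moments c :=
  forall k : nat, charge_integrable c (fun x => x ^+ k).

Lemma charge_integrable_horner c u :
  charge_moments c -> charge_integrable c (horner u).
Proof.
move=> mc; rewrite -(coefK u) poly_def.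
elim: (size u) => [|n IHn].
  rewrite big_ord0 (_ : horner 0 = fun x => 0 * x ^+ 0).
    by have [] := charge_integralZ 0 (mc 0%N).
  by apply/funext => x; rewrite horner0 mul0r.
rewrite big_ord_recr /= (_ : horner _ = fun x =>
    (\sum_(i < n) u`_i *: 'X^i).[x] + u`_n * x ^+ n).
  by apply: (charge_integralD IHn (charge_integralZ _ (mc n)).1).1.
by apply/funext => x; rewrite hornerD hornerZ hornerXn.
Qed.

Lemma charge_integral_hornerD c u v : charge_moments c ->
  charge_integral c (horner (u + v)) =
  charge_integral c (horner u) + charge_integral c (horner v).
Proof.
move=> mc; rewrite -(charge_integralD (charge_integrable_horner u mc)
  (charge_integrable_horner v mc)).2.
by congr charge_integral; apply/funext => x; rewrite hornerD.
Qed.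

Lemma charge_integral_hornerZ c (a : R) u : charge_moments c ->
  charge_integral c (horner (a *: u)) = a * charge_integral c (horner u).
Proof.
move=> mc; rewrite -(charge_integralZ _ (charge_integrable_horner u mc)).2.
by congr charge_integral; apply/funext => x; rewrite hornerZ.
Qed.

Lemma charge_moments_density c u : charge_moments c ->
  charge_moments (charge_density (horner u) c).
Proof.
move=> mc k; apply: (charge_integral_density _ _ _).1 => //.
  exact: charge_integrable_horner.
rewrite (_ : _ \* _ = horner ('X^k * u)); first exact: charge_integrable_horner.
by apply/funext => x; rewrite hornerM hornerXn.
Qed.

Lemma charge_integral_horner_density c u v : charge_moments c ->
  charge_integral (charge_density (horner u) c) (horner v) =
  charge_integral c (horner (v * u)).
Proof.
move=> mc.
have E : horner v \* horner u = horner (v * u).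
  by apply/funext => x; rewrite hornerM.
rewrite -E; apply: (charge_integral_density _ _ _).2.
- apply/measurable_EFinP.
  exact: (measurable_int _ (charge_integrable_horner v mc).1).
- exact: charge_integrable_horner.
- by rewrite E; exact: charge_integrable_horner.
Qed.

(** Taking parts of the coefficients keeps both parts polynomials, so finite moments suffice for
    integrability; on the real line they are the parts of the values of [p]. *)
Definition Re_poly p : {poly R} := \poly_(i < size p) complex.Re p`_i.
Definition Im_poly p : {poly R} := \poly_(i < size p) complex.Im p`_i.

Lemma horner_complex p (x : R) :
  p.[x%:C] = (Re_poly p).[x] +i* (Im_poly p).[x].
Proof.
rewrite horner_coef !horner_poly.
elim: (size p) => [|n IHn]; first by rewrite !big_ord0.
rewrite !big_ord_recr /= IHn -rmorphXn /=.
by case: (p`_n) => a b; simpc.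
Qed.

Lemma coef_Re_poly p i : (Re_poly p)`_i = complex.Re p`_i.
Proof. by rewrite coef_poly; case: ltnP => // /(nth_default 0) ->. Qed.

Lemma coef_Im_poly p i : (Im_poly p)`_i = complex.Im p`_i.
Proof. by rewrite coef_poly; case: ltnP => // /(nth_default 0) ->. Qed.

Lemma Re_horner p :
  (fun x : R => complex.Re p.[x%:C]) = horner (Re_poly p).
Proof. by apply/funext => x; rewrite horner_complex. Qed.

Lemma Im_horner p :
  (fun x : R => complex.Im p.[x%:C]) = horner (Im_poly p).
Proof. by apply/funext => x; rewrite horner_complex. Qed.

Lemma poly_integralE mu p : poly_integral mu p =
  (charge_integral (re_part mu) (horner (Re_poly p)) -
   charge_integral (im_part mu) (horner (Im_poly p))) +i*
  (charge_integral (re_part mu) (horner (Im_poly p)) +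
   charge_integral (im_part mu) (horner (Re_poly p))).
Proof. by rewrite /poly_integral /cintegral Re_horner Im_horner. Qed.

(** The difference is written with [-1 *:] so that [charge_integral_hornerD] and
    [charge_integral_hornerZ] rewrite it. *)
Lemma Re_polyM p q :
  Re_poly (p * q) = Re_poly p * Re_poly q + -1 *: (Im_poly p * Im_poly q).
Proof.
apply/polyP => k; rewrite coefD coefZ mulN1r !coefM coef_Re_poly coefM raddf_sum /=.
rewrite -sumrB; apply: eq_bigr => i _.
by rewrite !coef_Re_poly !coef_Im_poly; case: p`_i; case: q`_(k - i).
Qed.

Lemma Im_polyM p q :
  Im_poly (p * q) = Re_poly p * Im_poly q + Im_poly p * Re_poly q.
Proof.
apply/polyP => k; rewrite coefD !coefM coef_Im_poly coefM raddf_sum /=.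
rewrite -big_split; apply: eq_bigr => i _.
by rewrite !coef_Re_poly !coef_Im_poly; case: p`_i; case: q`_(k - i).
Qed.

Lemma poly_integral_scalar mu : finite_moments mu ->
  scalar (poly_integral mu).
Proof.
move=> mmu a p q.
have mr k : charge_integrable (re_part mu) (fun x => x ^+ k) := (mmu k).1.
have mi k : charge_integrable (im_part mu) (fun x => x ^+ k) := (mmu k).2.
have ReE : Re_poly (a *: p + q) = complex.Re a *: Re_poly p +
    (- complex.Im a *: Im_poly p + Re_poly q).
  apply/polyP => k; rewrite !(coefD, coefZ, coef_Re_poly, coef_Im_poly).
  by case: (p`_k) (q`_k) a => ? ? [? ?] [? ?] /=; ring.
have ImE : Im_poly (a *: p + q) = complex.Re a *: Im_poly p +
    (complex.Im a *: Re_poly p + Im_poly q).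
  apply/polyP => k; rewrite !(coefD, coefZ, coef_Re_poly, coef_Im_poly).
  by case: (p`_k) (q`_k) a {ReE} => ? ? [? ?] [? ?] /=; ring.
rewrite !poly_integralE ReE ImE.
rewrite !(charge_integral_hornerD, charge_integral_hornerZ)//.
case: a {ReE ImE} => a b /=.
by apply/eqP; rewrite eq_complex /=; apply/andP; split; apply/eqP; ring.
Qed.

Lemma poly_integral_cdensity mu p q : finite_moments mu ->
  poly_integral (cdensity (fun x => q.[x%:C]) mu) p = poly_integral mu (p * q).
Proof.
move=> mmu.
have mr : charge_moments (re_part mu) by move=> k; case: (mmu k).
have mi : charge_moments (im_part mu) by move=> k; case: (mmu k).
have md c u v : charge_moments c ->
    charge_integrable (charge_density (horner u) c) (horner v).
  by move=> mc; apply: charge_integrable_horner; exact: charge_moments_density.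
rewrite !poly_integralE /cdensity Re_horner Im_horner /=.
have coppE c v : charge_integrable c (horner v) -> _ :=
  @charge_integral_copp _ c (horner v).
have caddE c c' v := @charge_integral_cadd _ c c' (horner v).
rewrite !(caddE _ _ _ _ _).2 ?(coppE _ _ _).2 ?(coppE _ _ _).1//; try exact: md;
  try by apply: (coppE _ _ _).1; exact: md.
rewrite !charge_integral_horner_density// Re_polyM Im_polyM.
rewrite !(charge_integral_hornerD, charge_integral_hornerZ)//.
by congr (_ +i* _); ring.
Qed.

End PolynomialIntegrals.

(** * Normality as nondegeneracy of the moment matrix *)

Section MomentFunctionals.
Variables (F : fieldType) (r : nat).
Implicit Types (L : 'I_r -> {poly F} -> F) (n : 'I_r -> nat).
Implicit Types (A : 'I_r -> {poly F}) (P : {poly F}).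

Definition is_type_II L n P :=
  [/\ P \is monic, size P = (msum n).+1 &
      forall (i : 'I_r) (k : nat), (k < n i)%N -> L i (P * 'X^k) = 0].

(** Independence of the rows of the moment matrix, phrased through polynomial vectors: the
    homogeneous type I system has only the trivial solution. *)
Definition type_I_nondegenerate L n := forall A,
  (forall i, size (A i) <= n i)%N ->
  (forall k, (k < msum n)%N -> \sum_(i < r) L i (A i * 'X^k) = 0) ->
  forall i, A i = 0.

Section MomentMatrix.
Variables (L : 'I_r -> {poly F} -> F) (n : 'I_r -> nat).
Hypothesis L_scalar : forall i, scalar (L i).

HB.instance Definition _ i :=
  GRing.isLinear.Build F {poly F} F *%R (L i) (L_scalar i).

Let I := {i : 'I_r & 'I_(n i)}.

Let deg (x : I) : nat := tagged x.

Let idx i (p : 'I_(n i)) : I := Tagged (fun i => 'I_(n i)) p.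

Let card_I : #|{: I}| = msum n.
Proof.
rewrite card_tagged sumnE big_map /msum big_enum /=.
by apply: eq_bigr => i _; rewrite card_ord.
Qed.

(** Rows run through an enumeration of the pairs [(i, p)], which avoids block offsets. By [row_M],
    vectors on the left of [M] are type I vectors; by [M_col], vectors on the left of its transpose
    are polynomials of degree below [msum n]. *)
Let M : 'M[F]_(#|{: I}|, msum n) :=
  \matrix_(s, k) L (tag (enum_val s)) 'X^(deg (enum_val s) + k).

Let functional_sum i P Q d : (size P <= d)%N ->
  L i (P * Q) = \sum_(p < d) P`_p * L i ('X^p * Q).
Proof.
move=> sP; have PE : P = \poly_(p < d) P`_p.
  apply/polyP => k; rewrite coef_poly; case: ltnP => // /(leq_trans sP).
  by move/(nth_default 0).
rewrite [in LHS]PE poly_def mulr_suml linear_sum.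
apply: eq_bigr => p _.
by rewrite -scalerAl linearZ.
Qed.

Let row_M (A : 'I_r -> {poly F}) (k : 'I_(msum n)) :
  (forall i, size (A i) <= n i)%N ->
  (((\row_s (A (tag (enum_val s)))`_(deg (enum_val s))) : 'rV_#|{: I}|)
     *m M) 0 k = \sum_(i < r) L i (A i * 'X^k).
Proof.
move=> sA; rewrite mxE.
pose G (x : I) := (A (tag x))`_(deg x) * L (tag x) 'X^(deg x + k).
transitivity (\sum_(s < #|{: I}|) G (enum_val s)).
  by apply: eq_bigr => s _; rewrite !mxE.
transitivity (\sum_x G x).
  by rewrite [RHS](reindex _ (onW_bij _ (@enum_val_bij I))).
transitivity (\sum_i \sum_(p < n i) (A i)`_p * L i 'X^(p + k)).
  by rewrite (sig_big_dep xpredT (fun _ => xpredT) (fun i (p : 'I_(n i)) =>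
    (A i)`_p * L i 'X^(p + k))).
apply: eq_bigr => i _; rewrite (functional_sum _ _ (sA i)).
by apply: eq_bigr => p _; rewrite exprD.
Qed.

Let M_col P s : (size P <= msum n)%N ->
  (((\row_k P`_k) : 'rV_(msum n)) *m M^T) 0 s =
  L (tag (enum_val s)) (P * 'X^(deg (enum_val s))).
Proof.
move=> sP; rewrite mxE (functional_sum _ _ sP); apply: eq_bigr => k _.
by rewrite !mxE -exprD addnC.
Qed.

Let nondegenerate_row_free : type_I_nondegenerate L n -> row_free M.
Proof.
move=> nd; apply: inj_row_free => v vM0.
pose a (x : I) := v 0 (enum_rank x).
(* [insub p] succeeds for every [p < n i], so the default value 0 is never read. *)
pose A i := \poly_(p < n i) oapp (fun q : 'I_(n i) => a (idx q)) 0 (insub p).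
have aE (x : I) : (A (tag x))`_(deg x) = a x.
  case: x => i p /=; rewrite /deg /= coef_poly ltn_ord.
  by rewrite valK.
have sA i : (size (A i) <= n i)%N by exact: size_poly.
have vE : v = \row_s (A (tag (enum_val s)))`_(deg (enum_val s)).
  by apply/rowP => s; rewrite mxE aE /a enum_valK.
have A0 : forall i, A i = 0.
  apply: nd => // k ltk; rewrite -(row_M (Ordinal ltk) sA) -vE vM0.
  by rewrite mxE.
by apply/rowP => s; rewrite vE !mxE A0 coef0.
Qed.

Let row_free_nondegenerate : row_free M -> type_I_nondegenerate L n.
Proof.
move=> fM A sA A0 i.
have /eqP : (\row_s (A (tag (enum_val s)))`_(deg (enum_val s)) :
    'rV_#|{: I}|) = 0.
  apply/eqP; rewrite -(mulmx_free_eq0 _ fM); apply/eqP/rowP => k.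
  by rewrite row_M// A0// mxE.
move=> /eqP v0; apply/polyP => p; rewrite coef0.
case: (ltnP p (n i)) => [ltp|]; last first.
  by move=> /(leq_trans (sA i)) /(nth_default 0).
move/rowP/(_ (enum_rank (idx (Ordinal ltp)))): v0.
by rewrite !mxE enum_rankK.
Qed.

Let tr_row_free : row_free M^T = row_free M.
(* The rank is compared with the two dimensions of [M], which agree by [card_I] from the context:
   the matrix is square. *)
Proof. by rewrite /row_free mxrank_tr; congr (_ == _). Qed.

(** A kernel vector of the transpose is a polynomial [Q] of degree below [msum n] with all the
    orthogonality relations; then [P + Q] is also of type II, and uniqueness forces [Q = 0]. *)
Let type_II_row_free P : is_type_II L n P ->
  (forall P', is_type_II L n P' -> P = P') -> row_free M.
Proof.
move=> [mP sP oP] uP; rewrite -tr_row_free; apply: inj_row_free => w wM0.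
pose Q := \poly_(k < msum n) oapp (w 0) 0 (insub k).
have wE : w = \row_k Q`_k.
  by apply/rowP => k; rewrite mxE coef_poly ltn_ord valK.
have sQ : (size Q <= msum n)%N by exact: size_poly.
suff Q0 : Q = 0 by apply/rowP => k; rewrite wE !mxE Q0 coef0.
have ltQP : (size Q < size P)%N by rewrite sP ltnS.
suff /uP/eqP : is_type_II L n (P + Q).
  by rewrite -subr_eq0 opprD addNKr oppr_eq0 => /eqP.
split; first by rewrite monicE lead_coefDl// -monicE.
  by rewrite size_polyDl.
move=> i k ltk; rewrite mulrDl linearD /= oP// add0r.
have := M_col (enum_rank (idx (Ordinal ltk))) sQ.
by rewrite -wE wM0 mxE enum_rankK /=.
Qed.

Let row_free_type_II : row_free M -> exists! P, is_type_II L n P.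
Proof.
move=> fM; have fMt : row_free M^T by rewrite tr_row_free.
have fullMt : row_full M^T.
  by rewrite /row_full mxrank_tr.
have orth P : (size P <= msum n)%N ->
    (forall i k, (k < n i)%N -> L i (P * 'X^k) = 0) -> P = 0.
  move=> sP oP; have : (\row_k P`_k : 'rV_(msum n)) = 0.
    apply/eqP; rewrite -(mulmx_free_eq0 _ fMt); apply/eqP/rowP => s.
    by rewrite M_col// [RHS]mxE; apply: oP; exact: ltn_ord.
  move=> /rowP v0; apply/polyP => k; rewrite coef0.
  case: (ltnP k (msum n)) => [ltk|]; last first.
    by move=> /(leq_trans sP) /(nth_default 0).
  by have := v0 (Ordinal ltk); rewrite !mxE.
(* These are the moments of ['X^(msum n)]. A polynomial [Q] of lower degree with the same moments
   exists by full rank, and the difference is of type II. *)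
pose b : 'rV_#|{: I}| := \row_s
  L (tag (enum_val s)) ('X^(msum n) * 'X^(deg (enum_val s))).
have /submxP[w wE] := submx_full b fullMt.
pose Q := \poly_(k < msum n) oapp (w 0) 0 (insub k).
have wQ : w = \row_k Q`_k.
  by apply/rowP => k; rewrite mxE coef_poly ltn_ord valK.
have sQ : (size Q <= msum n)%N by exact: size_poly.
have tP : is_type_II L n ('X^(msum n) - Q).
  have ltQ : (size (- Q) < size ('X^(msum n) : {poly F}))%N.
    by rewrite size_polyN size_polyXn ltnS.
  split.
  - by rewrite monicE lead_coefDl// lead_coefXn.
  - by rewrite size_polyDl// size_polyXn.
  move=> i k ltk; rewrite mulrBl linearB /=.
  have := M_col (enum_rank (idx (Ordinal ltk))) sQ.
  by rewrite -wQ -wE mxE enum_rankK /= => ->; rewrite subrr.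
exists ('X^(msum n) - Q); split=> // P [mP sP oP].
case: tP => mP0 sP0 oP0; apply/eqP; rewrite -subr_eq0; apply/eqP/orth.
  (* Two monic polynomials of the same degree differ by one of lower degree, to which [orth]
     applies. *)
  apply/leq_sizeP => k; rewrite leq_eqVlt => /predU1P[<-|ltk].
    move: mP mP0; rewrite !monicE !lead_coefE sP sP0 /= => /eqP E /eqP E0.
    by rewrite coefB E E0 subrr.
  by rewrite coefB !nth_default ?subrr// ?sP ?sP0.
by move=> i k ltk; rewrite mulrBl linearB /= oP// oP0// subrr.
Qed.

(** Type II solutions concern the columns of the square matrix [M], homogeneous type I solutions its
    rows; both conditions say that [M] is invertible. *)
Lemma unique_type_IIP :
  (exists! P, is_type_II L n P) <-> type_I_nondegenerate L n.
Proof.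
split=> [[P [tP uP]]|nd].
  by apply: row_free_nondegenerate; exact: type_II_row_free tP uP.
by apply: row_free_type_II; exact: nondegenerate_row_free.
Qed.

End MomentMatrix.
End MomentFunctionals.

(** * The Wronskian of type I components and the transformed system *)

Section Wronskian.
Variables (F : fieldType) (r : nat).
Implicit Types (n : 'I_r -> nat) (A B C : 'I_r -> {poly F}) (p q : {poly F}).

Lemma double_rootP p z :
  p.[z] = 0 -> p^`().[z] = 0 -> exists q, p = q * ('X - z%:P) ^+ 2.
Proof.
move=> /rootP/factor_theorem[q ->].
rewrite derivM derivXsubC mulr1 hornerD !hornerM !hornerXsubC subrr mulr0 add0r.
by move=> /rootP/factor_theorem[q' ->]; exists q'; rewrite expr2 mulrA.
Qed.

Lemma horner_double_root q z : (q * ('X - z%:P) ^+ 2).[z] = 0.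
Proof. by rewrite hornerM horner_exp hornerXsubC subrr expr0n mulr0. Qed.

Lemma deriv_double_root q z : (q * ('X - z%:P) ^+ 2)^`().[z] = 0.
Proof.
by rewrite expr2 !derivM !derivXsubC !hornerE /=; ring.
Qed.

Lemma msum_msub n m j : (m <= n j)%N -> msum (msub n m j) = (msum n - m)%N.
Proof.
move=> lemn; rewrite /Defs.msum (bigD1 j)//= [in RHS](bigD1 j)//= /msub eqxx.
rewrite addnBAC//; congr (_ + _ - _)%N.
by apply: eq_bigr => i /negPf ->.
Qed.

Lemma msub_le n m j i : (msub n m j i <= n i)%N.
Proof. by rewrite /msub; case: ifP => // _; exact: leq_subr. Qed.

Variable L : 'I_r -> {poly F} -> F.
Hypothesis L_scalar : forall i, scalar (L i).

Let L0 i : L i 0 = 0.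
Proof. by have := L_scalar i (-1) 0 0; rewrite scaler0 addr0 mulN1r addNr. Qed.

Let S A k := \sum_(i < r) L i (A i * 'X^k).

Let S_comb (x y : F) A B k :
  S (fun i => x *: A i + y *: B i) k = x * S A k + y * S B k.
Proof.
rewrite /S !mulr_sumr -big_split; apply: eq_bigr => i _ /=.
rewrite mulrDl -scalerAl L_scalar; congr (_ + _).
by rewrite -scalerAl -[y *: _]addr0 L_scalar L0 addr0.
Qed.

Definition is_type_I n A :=
  [/\ exists i, A i != 0,
      forall i, (size (A i) <= n i)%N,
      forall k, (k.+1 < msum n)%N -> S A k = 0 &
      forall k, k.+1 = msum n -> S A k = 1].

(** If the [j]-th component had lower degree, [A] would be a non-trivial homogeneous solution at
    [n - e_j]. *)
Lemma size_type_I n j A : (0 < n j)%N ->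
  type_I_nondegenerate L (msub n 1 j) -> is_type_I n A -> size (A j) = n j.
Proof.
move=> nj0 nd [[i Ai0] sA oA _]; apply/eqP; rewrite eqn_leq sA /= leqNgt.
apply/negP => ltA; move: Ai0; rewrite nd ?eqxx// => [i'|k].
  rewrite /msub; case: eqVneq => [->|_]; last exact: sA.
  by rewrite -ltnS subn1 prednK.
by rewrite msum_msub// => ltk; apply: oA; lia.
Qed.

Definition Christoffel (j : 'I_r) (z : F) (i : 'I_r) p :=
  if i == j then L i (p * ('X - z%:P) ^+ 2) else L i p.

(* The vectors orthogonal to all powers below [msum n - 2] are the
   combinations of [A] and [B], and [Christoffel] picks those whose [j]-th
   component has a double zero at [z]. *)
Lemma wronskian_nondegenerateP n j l A B z : (2 <= n j)%N -> (1 <= n l)%N ->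
  type_I_nondegenerate L n -> is_type_I n A -> is_type_I (msub n 1 l) B ->
  type_I_nondegenerate (Christoffel j z) (msub n 2 j) <->
  ~~ root (A j * (B j)^`() - (A j)^`() * B j) z.
Proof.
move=> nj2 nl1 nd [_ sA oA eA] [_ sB oB eB].
have N2 : (2 <= msum n)%N.
  by rewrite /Defs.msum (bigD1 j)//= (leq_trans nj2)// leq_addr.
rewrite msum_msub// in oB eB.
have sB' i : (size (B i) <= n i)%N := leq_trans (sB i) (msub_le _ _ _ _).
(* The moments [N] and [N.+1] of [A] are 0 and 1, and the moment [N] of [B] is 1. This triangular
   pattern determines the coefficients of a combination of [A] and [B]. *)
pose N := (msum n - 2)%N.
have SA0 : S A N = 0 by apply: oA; rewrite /N; lia.
have SA1 : S A N.+1 = 1 by apply: eA; rewrite /N; lia.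
have SB1 : S B N = 1 by apply: eB; rewrite /N; lia.
have SC (D : 'I_r -> {poly F}) k :
    \sum_(i < r) Christoffel j z i (D i * 'X^k) =
    S (fun i => if i == j then D i * ('X - z%:P) ^+ 2 else D i) k.
  rewrite /S; apply: eq_bigr => i _; rewrite /Christoffel; case: ifP => // _.
  by rewrite mulrAC.
split=> [ndC|W0].
  apply/negP => /rootP; rewrite hornerD hornerN !hornerM => W0.
  (* The Wronskian at [z] is the determinant of this 2 by 2 system. A kernel vector is read off a
     non-zero row; if both rows vanish, any vector serves. *)
  have [x [y [xy0 e0 e1]]] : exists x y : F, [/\ (x != 0) || (y != 0),
      x * (A j).[z] + y * (B j).[z] = 0 &
      x * (A j)^`().[z] + y * (B j)^`().[z] = 0].
    move: W0; set a := (A j).[z]; set b := (B j).[z].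
    set a' := (_)^`().[z]; set b' := (_)^`().[z] => W0.
    have [nz|] := boolP ((a != 0) || (b != 0)).
      exists b, (- a); split; first by rewrite oppr_eq0 orbC.
        by rewrite mulNr mulrC subrr.
      by rewrite -[RHS]oppr0 -W0; ring.
    rewrite negb_or !negbK => /andP[/eqP a0 /eqP b0].
    have [nz|] := boolP ((a' != 0) || (b' != 0)).
      exists b', (- a'); split; first by rewrite oppr_eq0 orbC.
        by rewrite a0 b0 !mulr0 addr0.
      by rewrite mulNr mulrC subrr.
    rewrite negb_or !negbK => /andP[/eqP a'0 /eqP b'0].
    by exists 1, 0; rewrite oner_eq0 a0 b0 a'0 b'0 !mulr0 addr0.
  pose C i := x *: A i + y *: B i.
  have sC i : (size (C i) <= n i)%N.
    rewrite (leq_trans (size_polyD _ _))// geq_max.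
    by rewrite !(leq_trans (size_scale_leq _ _)).
  have [||q qE] := @double_rootP (C j) z.
  - by rewrite hornerD !hornerZ.
  - by rewrite derivD !derivZ hornerD !hornerZ.
  (* Division by the double zero lowers the degree of the [j]-th component by two, so [D] fits the
     index [n - 2 e_j]. *)
  pose D i := if i == j then q else C i.
  have DE : (fun i => if i == j then D i * ('X - z%:P) ^+ 2 else D i) = C.
    by apply/funext => i; rewrite /D; case: eqP => [->|].
  have D0 : forall i, D i = 0.
    apply: ndC => [i|k].
      rewrite /D /msub; case: eqVneq => [->|_]; last exact: sC.
      have [->|q0] := eqVneq q 0; first by rewrite size_poly0.
      have := sC j; rewrite qE size_Mmonic ?monic_exp ?monicXsubC//.
      by rewrite size_exp_XsubC addn3 /=; lia.
    rewrite msum_msub// SC DE => ltk; rewrite S_comb oA; last by lia.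
    by rewrite oB ?mulr0 ?addr0//; lia.
  have C0 i : C i = 0.
    by rewrite -DE D0; case: ifP => // _; rewrite mul0r.
  have SC0 k : S C k = 0.
    by rewrite /S big1// => i _; rewrite C0 mul0r L0.
  have y0 : y = 0.
    by have := SC0 N; rewrite S_comb SA0 SB1 mulr0 add0r mulr1.
  have x0 : x = 0.
    by have := SC0 N.+1; rewrite S_comb SA1 y0 mul0r addr0 mulr1.
  by move: xy0; rewrite x0 y0 eqxx.
move=> D sD oD.
pose C i := if i == j then D i * ('X - z%:P) ^+ 2 else D i.
have sC i : (size (C i) <= n i)%N.
  have := sD i; rewrite /C /msub; case: eqVneq => [->|//].
  have [->|q0] := eqVneq (D j) 0; first by rewrite mul0r size_poly0.
  rewrite size_Mmonic ?monic_exp ?monicXsubC//.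
  by rewrite size_exp_XsubC addn3 /=; lia.
have SC0 k : (k < N)%N -> S C k = 0.
  by move=> ltk; rewrite -SC; apply: oD; rewrite msum_msub.
(* Subtracting [b] times [B] kills the moment [N], and then [a] times [A] kills the moment [N.+1]
   without disturbing [N]. Nondegeneracy at [n] leaves nothing. The factors [1 *:] put the vectors
   in the form of [S_comb]. *)
pose b := S C N; pose C1 i := 1 *: C i + (- b) *: B i.
pose a := S C1 N.+1; pose C2 i := 1 *: C1 i + (- a) *: A i.
have C20 i : C2 i = 0.
  apply: nd => [i'|k ltk].
    rewrite /C2 /C1 !scale1r (leq_trans (size_polyD _ _))// geq_max.
    rewrite (leq_trans (size_polyD _ _))//= ?geq_max ?sC ?(leq_trans (size_scale_leq _ _))//.
  rewrite -/(S C2 k) S_comb.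
  have [ltkN|] := ltnP k N.
    rewrite S_comb SC0// oB; last by rewrite /N in ltkN *; lia.
    by rewrite oA; [rewrite !mulr0 !addr0 mulr0|rewrite /N in ltkN *; lia].
  rewrite leq_eqVlt => /predU1P[<-|ltNk].
    by rewrite S_comb SA0 SB1 -/b !mul1r mulr1 mulr0 subrr addr0.
  have -> : k = N.+1 by rewrite /N in ltNk *; lia.
  by rewrite SA1 -/a mul1r mulr1 subrr.
have CE i : C i = a *: A i + b *: B i.
  by have := C20 i; rewrite /C2 /C1 !scale1r !scaleNr => /eqP;
    rewrite subr_eq0 subr_eq => /eqP.
have Cj : C j = D j * ('X - z%:P) ^+ 2 by rewrite /C eqxx.
have e0 : a * (A j).[z] + b * (B j).[z] = 0.
  by rewrite -(horner_double_root (D j) z) -Cj CE hornerD !hornerZ.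
have e1 : a * (A j)^`().[z] + b * (B j)^`().[z] = 0.
  by rewrite -(deriv_double_root (D j) z) -Cj CE derivD !derivZ hornerD !hornerZ.
have Wz : (A j).[z] * (B j)^`().[z] - (A j)^`().[z] * (B j).[z] != 0.
  by move: W0; rewrite rootE hornerD hornerN !hornerM.
(* Cramer's rule for the equations [e0] and [e1], whose determinant is the Wronskian at [z]. *)
have a0 : a = 0.
  apply/eqP; rewrite -(mulIr_eq0 a (mulIf Wz)); apply/eqP.
  move/eqP: e0; rewrite addr_eq0 => /eqP e0; move/eqP: e1.
  rewrite addr_eq0 => /eqP e1.
  by rewrite mulrBr !mulrA e0 e1; ring.
have b0 : b = 0.
  apply/eqP; rewrite -(mulIr_eq0 b (mulIf Wz)); apply/eqP.
  move: e0 e1; rewrite a0 !mul0r !add0r => e0 e1.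
  by rewrite mulrBr mulrCA e1 mulrCA e0 !mulr0 subrr.
have C0 i : C i = 0 by rewrite CE a0 b0 !scale0r addr0.
move=> i; have := C0 i; rewrite /C; case: ifP => // _ /eqP.
by rewrite mulf_eq0 expf_eq0 /= polyXsubC_eq0 orbF => /eqP.
Qed.

End Wronskian.

(** * Sign changes and separation of zeros of real polynomials *)

Section RealPolynomials.
Variable R : rcfType.
Implicit Types (p q : {poly R}) (a b c x : R).

Lemma rootless_same_sign p a b : a <= b ->
  (forall x, a <= x <= b -> ~~ root p x) -> 0 < p.[a] * p.[b].
Proof.
move=> leab nr; rewrite ltNge; apply/negP => le0.
have [pa|pa|/eqP pa] := ltgtP p.[a] 0; last first.
- by have := nr a; rewrite lexx leab rootE pa => /(_ isT).
- have pb : p.[b] <= 0 by rewrite -(pmulr_rle0 _ pa).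
  have [|x /andP[ax xb] rx] := @poly_ivt R (- p) a b leab.
    by rewrite !hornerN oppr_le0 (ltW pa) oppr_ge0.
  by move: rx; rewrite rootN; apply/negP/nr; rewrite ax.
- have pb : 0 <= p.[b] by rewrite -(nmulr_rle0 _ pa).
  have [|x /andP[ax xb] rx] := @poly_ivt R p a b leab.
    by rewrite (ltW pa).
  by move: rx; apply/negP/nr; rewrite ax.
Qed.

(** The root is the head of the sorted list of roots in the open interval, or [b] if that list is
    empty. *)
Lemma next_rootP p a b : p != 0 -> a < b -> root p b ->
  exists c, [/\ a < c <= b, root p c & forall x, a < x < c -> ~~ root p x].
Proof.
move=> p0 ab rb; case E: (roots p a b) => [|c s].
  exists b; split; rewrite ?ab ?lexx// => x xab; apply/negP => rx.
  by have := in_roots p a b x; rewrite E rx p0 in_itv /= xab.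
have := in_roots p a b c; rewrite E mem_head => /esym/and3P[rc + _].
rewrite in_itv /= => /andP[ac cb]; exists c; split; rewrite ?ac ?(ltW cb)//.
move=> x /andP[ax xc]; apply/negP => rx.
have : x \in roots p a b by rewrite in_roots rx p0 in_itv /= ax (lt_trans xc).
have := sorted_roots a b p; rewrite E /= => /(order_path_min lt_trans) /allP sc.
rewrite inE => /predU1P[xE|/sc cx]; first by rewrite xE ltxx in xc.
by move: (lt_trans xc cx); rewrite ltxx.
Qed.

(** With [p = q (x - b) (x - a)] the derivatives are [q(a) (a - b)] and [q(b) (b - a)], and [q]
    keeps its sign on the closed interval. *)
Lemma deriv_consecutive_roots p a b : a < b -> root p a -> root p b ->
  p^`().[a] != 0 -> p^`().[b] != 0 ->
  (forall x, a < x < b -> ~~ root p x) -> p^`().[a] * p^`().[b] < 0.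
Proof.
move=> ab /factor_theorem[p1 pE] rb pa pb nr.
have /factor_theorem[q p1E] : root p1 b.
  by move: rb; rewrite pE rootM root_XsubC gt_eqF// orbF.
move: pa pb nr; rewrite pE p1E => pa pb nr.
have Ea : (q * ('X - b%:P) * ('X - a%:P))^`().[a] = q.[a] * (a - b).
  by rewrite !derivM !derivXsubC !hornerE /=; ring.
have Eb : (q * ('X - b%:P) * ('X - a%:P))^`().[b] = q.[b] * (b - a).
  by rewrite !derivM !derivXsubC !hornerE /=; ring.
rewrite Ea Eb in pa pb *.
have : 0 < q.[a] * q.[b].
  apply: rootless_same_sign (ltW ab) _ => x /andP[].
  rewrite le_eqVlt => /predU1P[<- _|ax].
    by apply/negP => /rootP q0; rewrite q0 mul0r eqxx in pa.
  rewrite le_eqVlt => /predU1P[->|xb].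
    by apply/negP => /rootP q0; rewrite q0 mul0r eqxx in pb.
  by have := nr x; rewrite ax xb !rootM !negb_or => /(_ isT) /andP[/andP[]].
by move=> q0; rewrite mulrACA pmulr_rlt0// pmulr_llt0 ?subr_gt0// subr_lt0.
Qed.

Lemma simple_root_sign q a b c : a < c < b -> root q c -> q^`().[c] != 0 ->
  (forall x, a <= x <= b -> root q x -> x = c) -> q.[a] * q.[b] < 0.
Proof.
move=> /andP[ac cb] /factor_theorem[q1 qE] qc uq.
have : 0 < q1.[a] * q1.[b].
  apply: rootless_same_sign => [|x xab]; first by rewrite ltW// (lt_trans ac).
  apply/negP => rx.
  have xE : x = c by apply: uq => //; rewrite qE rootM rx.
  move: qc; rewrite qE derivM derivXsubC !hornerE /=.
  by rewrite -xE (rootP rx) subrr mulr0 addr0 eqxx.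
rewrite qE !hornerM !hornerXsubC => q0.
by rewrite mulrACA pmulr_rlt0// pmulr_llt0 ?subr_gt0// subr_lt0.
Qed.

Let wr p q := p * q^`() - p^`() * q.

Let wr_rootl p q a : root p a -> (wr p q).[a] = - (p^`().[a] * q.[a]).
Proof.
by move=> /rootP pa; rewrite /wr hornerD hornerN !hornerM pa mul0r add0r.
Qed.

Let wrC p q : wr q p = - wr p q.
Proof. by rewrite /wr; ring. Qed.

Section RootlessWronskian.
Variables p q : {poly R}.
Hypothesis W0 : forall x, ~~ root (wr p q) x.

Let W_sign a b : 0 < (wr p q).[a] * (wr p q).[b].
Proof.
wlog leab : a b / a <= b.
  move=> H; case: (leP a b) => [|/ltW] /H//; by rewrite mulrC.
by apply: rootless_same_sign.
Qed.

Lemma wronskian_simple_root a : root p a -> p^`().[a] * q.[a] != 0.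
Proof. by move=> ra; have := W0 a; rewrite rootE wr_rootl// oppr_eq0. Qed.

(** The Wronskian has constant sign, and at a root of [p] it reduces to [- p' q]. *)
Lemma wronskian_root_sign a b : root p a -> root p b ->
  0 < (q.[a] * p^`().[a]) * (q.[b] * p^`().[b]).
Proof.
move=> ra rb; have := W_sign a b.
by rewrite !wr_rootl// mulrNN !(mulrC (p^`()).[_]).
Qed.

(** Between consecutive roots of [p] the sign of [p'] flips while that of [p' q] does not, so [q]
    must change sign. *)
Lemma wronskian_root_between a b : a < b -> root p a -> root p b ->
  exists c, a < c < b /\ root q c.
Proof.
move=> ab ra rb; apply: contrapT => nq.
have p0 : p != 0.
  apply/eqP => p0; have := wronskian_simple_root ra.
  by rewrite p0 deriv0 horner0 mul0r eqxx.
have [c [/andP[ac cb] rc nr]] := next_rootP p0 ab rb.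
have sa := wronskian_simple_root ra; have sc := wronskian_simple_root rc.
move: sa sc; rewrite !mulf_eq0 !negb_or => /andP[pa qa] /andP[pc qc].
have pp := deriv_consecutive_roots ac ra rc pa pc nr.
have qq : 0 < q.[a] * q.[c].
  apply: rootless_same_sign (ltW ac) _ => x /andP[].
  rewrite le_eqVlt => /predU1P[<- _|ax]; first by rewrite rootE.
  rewrite le_eqVlt => /predU1P[->|xc]; first by rewrite rootE.
  by apply/negP => rx; apply: nq; exists x; rewrite ax (lt_le_trans xc).
by have := wronskian_root_sign ra rc; rewrite mulrACA pmulr_rgt0// ltNge ltW.
Qed.

End RootlessWronskian.

(** Existence is [wronskian_root_between]. Two roots of [q] would, with the roles exchanged, enclose
    a root of [p] between consecutive ones. *)
Lemma wronskian_separated p q : (forall x, ~~ root (wr p q) x) ->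
  forall a b, a < b -> root p a -> root p b ->
  (forall c, a < c < b -> ~~ root p c) -> exists! c, a < c < b /\ root q c.
Proof.
move=> W0 a b ab ra rb nr.
have W0' x : ~~ root (wr q p) x by rewrite wrC rootN.
have [c [cab rc]] := wronskian_root_between W0 ab ra rb.
exists c; split=> // d [dab rd]; case: (ltgtP c d) => // lt.
- have [x [/andP[cx xd] rx]] := wronskian_root_between W0' lt rc rd.
  case/andP: cab dab => ac _ /andP[_ db]; have := nr x.
  by rewrite rx (lt_trans ac cx) (lt_trans xd db) => /(_ isT).
- have [x [/andP[cx xd] rx]] := wronskian_root_between W0' lt rd rc.
  case/andP: dab cab => ad _ /andP[_ cb]; have := nr x.
  by rewrite rx (lt_trans ad cx) (lt_trans xd cb) => /(_ isT).
Qed.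

(* On consecutive zeros of [p] both [q] and [p'] change sign. *)
Lemma separated_root_sign p q :
  (forall x, root p x -> p^`().[x] != 0) ->
  (forall x, root q x -> q^`().[x] != 0) ->
  (forall x, ~~ (root p x && root q x)) ->
  (forall a b, a < b -> root p a -> root p b ->
    (forall c, a < c < b -> ~~ root p c) -> exists! c, a < c < b /\ root q c) ->
  forall a b, root p a -> root p b ->
  0 < (q.[a] * p^`().[a]) * (q.[b] * p^`().[b]).
Proof.
move=> sp sq npq sep a b; wlog : a b / a <= b.
  move=> H ra rb; case: (leP a b) => [|/ltW] leab; first exact: H.
  by rewrite mulrC; apply: H.
have qp a' : root p a' -> q.[a'] != 0.
  by move=> ra; have := npq a'; rewrite ra.
rewrite le_eqVlt => /predU1P[<- ra _|].
  by rewrite -expr2 exprn_even_gt0//= mulf_neq0 ?qp ?sp.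
have p0 : root p a -> p != 0.
  by move=> ra; apply/eqP => p0; have := sp _ ra; rewrite p0 deriv0 horner0 eqxx.
(* Induction on the number of roots of [p] strictly between [a] and [b]: the step passes to the next
   root [c], which is no longer counted. *)
have [m] := ubnP (size (roots p a b)).
elim: m a p0 => // m IHm a p0 sm ab ra rb.
have [c [/andP[ac cb] rc nr]] := next_rootP (p0 ra) ab rb.
have [d [[dac rd] ud]] := sep _ _ ac ra rc nr.
have qq : q.[a] * q.[c] < 0.
  apply: (simple_root_sign dac rd (sq _ rd)) => x /andP[].
  rewrite le_eqVlt => /predU1P[<- _ /rootP qx|ax].
    by have := qp _ ra; rewrite qx eqxx.
  rewrite le_eqVlt => /predU1P[-> /rootP qx|xc rx].
    by have := qp _ rc; rewrite qx eqxx.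
  by apply/esym/ud; rewrite ax xc.
have pp := deriv_consecutive_roots ac ra rc (sp _ ra) (sp _ rc) nr.
have ac0 : 0 < (q.[a] * p^`().[a]) * (q.[c] * p^`().[c]).
  by rewrite mulrACA nmulr_rgt0.
move: cb; rewrite le_eqVlt => /predU1P[<-//|cb].
have cb0 : 0 < (q.[c] * p^`().[c]) * (q.[b] * p^`().[b]).
  apply: IHm => //; first by move=> _; exact: p0.
  rewrite -ltnS (leq_trans _ sm)// ltnS.
  have := @uniq_leq_size _ (c :: roots p c b) (roots p a b); apply=> [|x].
    by rewrite /= uniq_roots andbT in_roots in_itv /= ltxx andbF.
  rewrite inE => /predU1P[->|]; first by rewrite in_roots rc in_itv /= ac cb p0.
  rewrite !in_roots !in_itv /= => /and3P[-> /andP[cx ->] ->].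
  by rewrite (lt_trans ac cx).
(* The product of the two inequalities contains the positive factor [y * y], which is cancelled. *)
set y := q.[c] * p^`().[c] in ac0 cb0.
have y0 : y != 0 by apply: contraTneq ac0 => ->; rewrite mulr0 ltxx.
have y2 : 0 < y * y by rewrite -expr2 exprn_even_gt0.
by rewrite -(pmulr_lgt0 _ y2) mulrACA mulr_gt0// mulrC.
Qed.

End RealPolynomials.

(** * Partial fractions and the Bezoutian *)

Section PartialFractions.
Variable F : fieldType.
Implicit Types (p q : {poly F}) (s : seq F).

Lemma uniq_simple_roots k s :
  (forall a, a \in s ->
    (k *: \prod_(b <- s) ('X - b%:P))^`().[a] != 0) ->
  uniq s.
Proof.
elim: s k => //= a s IHs k simple; apply/andP; split.
  have := simple a (mem_head _ _).
  rewrite big_cons derivZ derivM derivXsubC !hornerE /= subrr mul0r addr0 => H.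
  by apply/negP => sa; move: H; rewrite (rootP _) ?mulr0 ?eqxx// root_prod_XsubC.
apply: (IHs k) => b sb; have := simple b; rewrite inE sb orbT => /(_ isT).
rewrite big_cons !derivZ derivM derivXsubC !hornerE /=.
have /rootP -> : root (\prod_(c <- s) ('X - c%:P)) b by rewrite root_prod_XsubC.
by rewrite add0r mulrCA mulf_eq0 negb_or => /andP[].
Qed.

Variables (p q : {poly F}) (k : F) (s : seq F).
Hypotheses (k0 : k != 0) (us : uniq s).
Hypothesis pE : p = k *: \prod_(a <- s) ('X - a%:P).
Hypothesis size_qp : (size q <= size p)%N.

Let cofactor a := p %/ ('X - a%:P).

Let root_p a : root p a = (a \in s).
Proof. by rewrite pE rootZ// root_prod_XsubC. Qed.

Let cofactorE a : a \in s -> p = cofactor a * ('X - a%:P).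
Proof. by move=> sa; rewrite /cofactor divpK// dvdp_XsubCl root_p. Qed.

Let cofactor_deriv a : a \in s -> (cofactor a).[a] = p^`().[a].
Proof.
move=> sa; rewrite [in RHS](cofactorE sa) derivM derivXsubC mulr1.
by rewrite hornerD hornerM hornerXsubC subrr mulr0 add0r.
Qed.

Let cofactor0 a b : a \in s -> b \in s -> a != b -> (cofactor a).[b] = 0.
Proof.
move=> sa sb ab; have := sb; rewrite -root_p {1}(cofactorE sa) rootM.
by rewrite root_XsubC (eq_sym b) (negPf ab) orbF => /rootP.
Qed.

Let size_p : size p = (size s).+1.
Proof. by rewrite pE size_scale// size_prod_XsubC. Qed.

Let deriv_p a : a \in s -> p^`().[a] != 0.
Proof.
move=> sa; rewrite -cofactor_deriv//.
have -> : cofactor a = k *: \prod_(b <- rem a s) ('X - b%:P).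
  apply: (mulIf (negbT (polyXsubC_eq0 a))); rewrite -cofactorE// pE.
  by rewrite (perm_big _ (perm_to_rem sa)) big_cons -scalerAl mulrC.
by apply/negP; rewrite -/(root _ a) rootZ// root_prod_XsubC mem_rem_uniq// inE eqxx.
Qed.

(** Lagrange interpolation: both sides agree at the [size s] distinct roots of [p], and [c] is
    chosen so that their difference has degree below [size s]. *)
Lemma partial_fractions : exists c,
  q = c *: p + \sum_(a <- s) (q.[a] / p^`().[a]) *: cofactor a.
Proof.
have pk : p`_(size s) = k.
  have := lead_coefE p; rewrite size_p /= => <-.
  by rewrite pE lead_coefZ (monicP (monic_prod_XsubC _ _ _)) mulr1.
(* If the degree of [q] is below that of [p], this coefficient is 0, and so is the constant. *)
exists (q`_(size s) / k); apply/eqP; rewrite -subr_eq0; apply/negPn/negP => D0.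
suff : all (root (q - ((q`_(size s) / k) *: p +
    \sum_(a <- s) (q.[a] / p^`().[a]) *: cofactor a))) s.
  move=> /(max_poly_roots D0) /(_ us); rewrite ltnNge => /negP; apply.
  rewrite opprD addrA (leq_trans (size_polyD _ _))// size_polyN geq_max.
  apply/andP; split.
    apply/leq_sizeP => m; rewrite leq_eqVlt => /predU1P[<-|lt].
      by rewrite coefB coefZ pk divfK// subrr.
    have pm : p`_m = 0 by apply: nth_default; rewrite size_p.
    have qm : q`_m = 0.
      by apply: nth_default; rewrite (leq_trans size_qp)// size_p.
    by rewrite coefB coefZ pm qm mulr0 subrr.
  apply: (big_ind (fun f : {poly F} => (size f <= size s)%N)).
  - by rewrite size_poly0.
  - by move=> f g sf sg; rewrite (leq_trans (size_polyD _ _))// geq_max sf.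
  move=> a _; rewrite (leq_trans (size_scale_leq _ _))//.
  by rewrite size_divp ?polyXsubC_eq0// size_p size_XsubC subn1.
apply/allP => b sb; rewrite rootE hornerD hornerN hornerD hornerZ.
have /rootP -> : root p b by rewrite root_p.
rewrite mulr0 add0r horner_sum (bigD1_seq b)//= hornerZ cofactor_deriv//.
rewrite divfK ?deriv_p// big_seq_cond big1 ?addr0 ?subrr// => a /andP[sa ab].
by rewrite hornerZ cofactor0 ?mulr0.
Qed.

(** The multiple of [p] in [q] cancels, and in the term of [a] the factors [w - a] and [z - a] leave
    the difference [w - z]. *)
Lemma bezoutianE z w : q.[z] * p.[w] - q.[w] * p.[z] = (w - z) *
  \sum_(a <- s) (q.[a] / p^`().[a]) * ((cofactor a).[z] * (cofactor a).[w]).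
Proof.
have [c qE] := partial_fractions.
set D := w - z.
have E x : q.[x] = c * p.[x] + \sum_(a <- s) (q.[a] / p^`().[a]) * (cofactor a).[x].
  rewrite [in LHS]qE hornerD hornerZ; congr (_ + _).
  by rewrite horner_sum; apply: eq_bigr => a _; rewrite hornerZ.
rewrite E (E w) [in X in X - _]mulrDl [in X in _ - X]mulrDl.
rewrite opprD addrACA [X in X + _](_ : _ = 0) ?add0r; last by ring.
rewrite !mulr_suml -sumrB mulr_sumr; apply: eq_big_seq => a sa.
have px x : p.[x] = (cofactor a).[x] * (x - a).
  by rewrite {1}(cofactorE sa) hornerM hornerXsubC.
by rewrite !px /D; ring.
Qed.

(** The confluent case of the Bezoutian identity, derived term by term from
    [p = cofactor a * (x - a)] instead of by a limit. *)
Lemma wronskianE : p * q^`() - p^`() * q =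
  - \sum_(a <- s) (q.[a] / p^`().[a]) *: cofactor a ^+ 2.
Proof.
have [c qE] := partial_fractions.
rewrite [in q^`()]qE [X in _ - _ * X]qE derivD derivZ.
rewrite !mulrDr opprD addrACA [X in X + _](_ : _ = 0) ?add0r; last first.
  by rewrite -!mul_polyC; ring.
rewrite raddf_sum !mulr_sumr -sumrB -sumrN; apply: eq_big_seq => a sa.
have dp : p^`() = (cofactor a)^`() * ('X - a%:P) + cofactor a.
  by rewrite {1}(cofactorE sa) derivM derivXsubC mulr1.
rewrite /= derivZ -!scalerAr -scalerBr -scalerN; congr (_ *: _).
rewrite dp {1}(cofactorE sa); ring.
Qed.

End PartialFractions.

(** * Consequences of residues of one sign *)

Section SameSignResidues.
Variable C : numClosedFieldType.
Variables (p q : {poly C}) (k : C) (s : seq C).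
Hypotheses (k0 : k != 0) (us : uniq s) (s0 : s != [::]).
Hypothesis pE : p = k *: \prod_(a <- s) ('X - a%:P).
Hypothesis size_qp : (size q <= size p)%N.
Hypotheses (p_real : map_poly Num.conj p = p) (q_real : map_poly Num.conj q = q).
Hypothesis s_real : {in s, forall a, a \is Num.real}.
Hypothesis same_sign : {in s &, forall a b,
  0 < (q.[a] * p^`().[a]) * (q.[b] * p^`().[b])}.

Let cofactor a := p %/ ('X - a%:P).

Let deriv_real a : a \in s -> p^`().[a] \is Num.real.
Proof.
move=> sa; apply/CrealP; rewrite -horner_map /= -deriv_map p_real.
by rewrite (CrealP (s_real sa)).
Qed.

(** The terms are residues times [|cofactor a (z)|^2], hence of one sign. If the sum vanished, every
    cofactor would vanish at [z]; then [z] would be a root of [p], yet its own cofactor takes the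
    value [p'(z)], which is non-zero. *)
Let bezoutian_conj_neq0 z :
  \sum_(a <- s) (q.[a] / p^`().[a]) *
    ((cofactor a).[z] * (cofactor a).[Num.conj z]) != 0.
Proof.
have [a0 sa0] : exists a, a \in s.
  by case: s s0 => // a t _; exists a; rewrite mem_head.
have dp a : a \in s -> p^`().[a] != 0.
  move=> sa; have := same_sign sa sa; rewrite -expr2 => H.
  by apply/eqP => d0; move: H; rewrite d0 mulr0 expr0n ltxx.
have cof_conj a : a \in s -> (cofactor a).[Num.conj z] = Num.conj (cofactor a).[z].
  move=> sa; rewrite -horner_map /= map_divp map_polyXsubC /= p_real.
  by rewrite (CrealP (s_real sa)).
(* Multiplication by [e] makes all residues positive, whichever sign they share. *)
pose e := q.[a0] * p^`().[a0].
pose G a := (e * (q.[a] / p^`().[a])) * `|(cofactor a).[z]| ^+ 2.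
have e_gt0 a : a \in s -> 0 < e * (q.[a] / p^`().[a]).
  move=> sa; have := same_sign sa0 sa; rewrite -/e => H.
  have d2 : 0 < p^`().[a] ^+ 2 by rewrite real_exprn_even_gt0 ?deriv_real ?dp.
  have -> : q.[a] / p^`().[a] = q.[a] * p^`().[a] / p^`().[a] ^+ 2.
    by field; exact: dp.
  by rewrite mulrA divr_gt0.
apply/eqP => sum0.
have G0 : \sum_(a <- s) G a = 0.
  transitivity (e * \sum_(a <- s) (q.[a] / p^`().[a]) *
    ((cofactor a).[z] * (cofactor a).[Num.conj z])); last by rewrite sum0 mulr0.
  rewrite mulr_sumr; apply: eq_big_seq => a sa.
  by rewrite /G cof_conj// normCK !mulrA.
have cof0 a : a \in s -> (cofactor a).[z] = 0.
  move=> sa; move: G0; rewrite big_seq => /eqP; rewrite psumr_eq0; last first.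
    by move=> b sb; rewrite mulr_ge0 ?exprn_ge0// ltW// e_gt0.
  move=> /allP /(_ a sa); rewrite sa /= mulf_eq0 gt_eqF ?e_gt0//=.
  by rewrite expf_eq0 /= normr_eq0 => /eqP.
have pz a : a \in s -> p.[z] = (cofactor a).[z] * (z - a).
  move=> sa; rewrite -hornerXsubC -hornerM /cofactor divpK// dvdp_XsubCl.
  by rewrite pE rootZ// root_prod_XsubC.
have sz : z \in s.
  by rewrite -root_prod_XsubC -(rootZ _ _ k0) -pE rootE (pz _ sa0) cof0 ?mul0r.
have := dp _ sz; rewrite -(divpK (_ : 'X - z%:P %| p)); last first.
  by rewrite dvdp_XsubCl pE rootZ// root_prod_XsubC.
rewrite derivM derivXsubC mulr1 hornerD hornerM hornerXsubC subrr mulr0 add0r.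
by rewrite -/(cofactor z) cof0// eqxx.
Qed.

Lemma same_sign_real_rooted z : root q z -> z \is Num.real.
Proof.
move=> /rootP qz; apply/CrealP/eqP; rewrite -subr_eq0.
have qzc : q.[Num.conj z] = 0 by rewrite -q_real horner_map /= qz rmorph0.
have := bezoutianE k0 us pE size_qp z (Num.conj z).
rewrite qz qzc !mul0r subrr => /esym/eqP.
by rewrite mulf_eq0 (negPf (bezoutian_conj_neq0 z)) orbF.
Qed.

Lemma same_sign_wronskian x : x \is Num.real ->
  ~~ root (p * q^`() - p^`() * q) x.
Proof.
move=> /CrealP xr; rewrite (wronskianE k0 us pE size_qp) rootN.
rewrite rootE horner_sum; have := bezoutian_conj_neq0 x; rewrite xr.
by under [X in _ -> X != 0]eq_bigr do rewrite hornerZ horner_exp expr2.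
Qed.

End SameSignResidues.

(** * Interlacing and the Wronskian *)

Section RealCoefficients.
Context {R : realType}.
Implicit Types p q : {poly R[i]}.
Local Notation f := (real_complex R).

Lemma real_coefs_map p : real_coefs p -> p = map_poly f (Re_poly p).
Proof.
move=> /polyOverP rp; apply/polyP => i.
by rewrite coef_map coef_Re_poly /= RRe_real.
Qed.

Lemma real_coefs_conj p : real_coefs p -> map_poly Num.conj p = p.
Proof.
by move=> /polyOverP rp; apply/polyP => i; rewrite coef_map /=; exact/CrealP.
Qed.

Lemma real_complex_real (x : R) : x%:C \is @Num.real R[i].
Proof. by rewrite complex_real. Qed.

Lemma simple_zerosP p : p != 0 ->
  simple_zeros p <-> forall z, root p z -> p^`().[z] != 0.
Proof.
move=> p0; split=> sp z rz.
  apply/eqP => pz; have [q pE] := double_rootP (rootP rz) pz.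
  have : (2 <= mup z p)%N by rewrite mup_geq// pE dvdp_mull.
  by rewrite sp.
apply/eqP; rewrite eqn_leq -XsubC_dvd// dvdp_XsubCl rz andbT mup_leq//.
apply/negP => /dvdpP[q pE]; have := sp z rz.
by rewrite pE deriv_double_root eqxx.
Qed.

(** Signs, derivatives and separation are handled for the real polynomials [p1] and [q1], the
    residue argument over [R[i]]. The converse uses that exchanging [p] and [q] only negates the
    Wronskian. *)
Lemma interlaceP p q : real_coefs p -> real_coefs q -> real_rooted p ->
  (1 < size p)%N -> (size q <= size p)%N ->
  interlace p q <-> forall x : R, ~~ root (wronskian p q) x%:C.
Proof.
move=> cp cq rp sp sqp.
have p0 : p != 0 by rewrite -size_poly_gt0 ltnW.
pose p1 := Re_poly p; pose q1 := Re_poly q.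
have pE : p = map_poly f p1 := real_coefs_map cp.
have qE : q = map_poly f q1 := real_coefs_map cq.
have rpE (x : R) : root p x%:C = root p1 x by rewrite pE fmorph_root.
have rqE (x : R) : root q x%:C = root q1 x by rewrite qE fmorph_root.
have hpE (x : R) : p.[x%:C] = (p1.[x])%:C by rewrite pE horner_map.
have hqE (x : R) : q.[x%:C] = (q1.[x])%:C by rewrite qE horner_map.
have hdpE (x : R) : p^`().[x%:C] = (p1^`().[x])%:C.
  by rewrite pE deriv_map horner_map.
have hdqE (x : R) : q^`().[x%:C] = (q1^`().[x])%:C.
  by rewrite qE deriv_map horner_map.
have WE (x : R) : root (wronskian p q) x%:C =
    root (p1 * q1^`() - p1^`() * q1) x.
  by rewrite /wronskian pE qE !deriv_map -!rmorphM -rmorphB fmorph_root.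
have C0 (x : R) : (x%:C != 0) = (x != 0) by rewrite fmorph_eq0.
have [s pF] := closed_field_poly_normal p.
set k := lead_coef p in pF.
have k0 : k != 0 by rewrite lead_coef_eq0.
have rs a : root p a = (a \in s) by rewrite pF rootZ// root_prod_XsubC.
have s_real : {in s, forall a, a \is Num.real} by move=> a; rewrite -rs; exact: rp.
(* The hypothesis [1 < size p] provides a zero, so that the sum over residues is not empty. *)
have s0 : s != [::].
  by apply/eqP => s0; move: sp; rewrite pF s0 big_nil alg_polyC size_polyC k0.
have sR a : a \in s -> exists2 x : R, a = x%:C & root p1 x.
  move=> sa; exists (complex.Re a); first by rewrite RRe_real ?s_real.
  by rewrite -rpE RRe_real ?s_real// rs.
have us : (forall z, root p z -> p^`().[z] != 0) -> uniq s.
  move=> simple; apply: (@uniq_simple_roots _ k) => a sa.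
  by rewrite -pF; apply: simple; rewrite rs.
have same : (forall a b, root p1 a -> root p1 b ->
     0 < (q1.[a] * p1^`().[a]) * (q1.[b] * p1^`().[b])) ->
    {in s &, forall a b, 0 < (q.[a] * p^`().[a]) * (q.[b] * p^`().[b])}.
  move=> H _ _ /sR[a -> ra] /sR[b -> rb].
  by rewrite !hqE !hdpE -!rmorphM /= ltcR; exact: H.
have pc := real_coefs_conj cp; have qc := real_coefs_conj cq.
split=> [[[_ q0] [_ simple_p] [_ simple_q] disj [sep_pq _]] x|W0].
  have dp := (simple_zerosP p0).1 simple_p.
  have dq := (simple_zerosP q0).1 simple_q.
  apply: (same_sign_wronskian k0 (us dp) s0 pF sqp pc s_real); last first.
    exact: real_complex_real.
  apply: same; apply: separated_root_sign.
  - by move=> y ry; rewrite -C0 -hdpE dp ?rpE.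
  - by move=> y ry; rewrite -C0 -hdqE dq ?rqE.
  - by move=> y; rewrite -rpE -rqE.
  move=> a b ab ra rb nr.
  have [|||c [[cab rc] uc]] := sep_pq a b ab.
  - by rewrite rpE.
  - by rewrite rpE.
  - by move=> c; rewrite rpE; exact: nr.
  exists c; split; first by rewrite -rqE.
  by move=> d [dab rd]; apply: uc; rewrite rqE.
have W1 x : ~~ root (p1 * q1^`() - p1^`() * q1) x by rewrite -WE.
have W1' x : ~~ root (q1 * p1^`() - q1^`() * p1) x.
  rewrite -rootN (_ : - _ = p1 * q1^`() - p1^`() * q1) ?W1//; ring.
have nz x : root p1 x -> (p1^`().[x] != 0) && (q1.[x] != 0).
  by move=> /(wronskian_simple_root W1); rewrite mulf_eq0 negb_or.
have nzq x : root q1 x -> (q1^`().[x] != 0) && (p1.[x] != 0).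
  by move=> /(wronskian_simple_root W1'); rewrite mulf_eq0 negb_or.
have dp z : root p z -> p^`().[z] != 0.
  by rewrite rs => /sR[x -> rx]; rewrite hdpE C0; case/andP: (nz x rx).
have rq : real_rooted q.
  move=> z; apply: (same_sign_real_rooted k0 (us dp) s0 pF sqp pc qc s_real).
  by apply: same => a b; exact: wronskian_root_sign W1 a b.
have q0 : q != 0.
  by apply/eqP => q0; have := W0 0; rewrite q0 /wronskian deriv0 !mulr0 subrr root0.
have sep (g h g1 h1 : {poly _}) : (forall x, root g x%:C = root g1 x) ->
    (forall x, root h x%:C = root h1 x) ->
    (forall x, ~~ root (g1 * h1^`() - g1^`() * h1) x) -> separated_by g h.
  move=> gE hE Wgh a b ab; rewrite !gE => ra rb nr.
  have [|c [[cab rc] uc]] := wronskian_separated Wgh ab ra rb.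
    by move=> c cab; rewrite -gE nr.
  by exists c; split; [rewrite hE|move=> d; rewrite hE; exact: uc].
split=> //.
- by split=> //; apply/simple_zerosP.
- split=> //; apply/simple_zerosP => // z rz.
  have zE : (complex.Re z)%:C = z by rewrite RRe_real ?rq.
  move: rz; rewrite -zE rqE => /nzq/andP[dq0 _].
  by rewrite hdqE C0.
- move=> z; apply/negP => /andP[]; rewrite rs => /sR[x -> /nz/andP[_ qx]].
  by rewrite rqE rootE (negPf qx).
- by split; [exact: sep rpE rqE W1|exact: sep rqE rpE W1'].
Qed.

End RealCoefficients.

(** * Normality for systems of measures, and the theorem *)

Section Normality.
Context {R : realType} {r : nat}.
Variable mu : 'I_r -> complex_measure R.
Hypothesis mu_moments : forall i, finite_moments (mu i).
Implicit Types (n : 'I_r -> nat) (A B : 'I_r -> {poly R[i]}).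

Let L i := poly_integral (mu i).

Let L_scalar i : scalar (L i).
Proof. exact: poly_integral_scalar. Qed.

Lemma normalP n : normal mu n <-> type_I_nondegenerate L n.
Proof. exact: unique_type_IIP L_scalar. Qed.

Let transform_functional j z :
  (fun i => poly_integral (transform mu j z i)) = Christoffel L j z.
Proof.
apply/funext => i; apply/funext => p; rewrite /transform /Christoffel.
case: ifP => _; last by [].
(* The density is rewritten as a polynomial restricted to the real line, the form required by
   [poly_integral_cdensity]. *)
have -> : (fun x : R => (x%:C - z) ^+ 2) =
    (fun x => (('X - z%:P) ^+ 2).[x%:C]).
  by apply/funext => x; rewrite horner_exp hornerXsubC.
exact: poly_integral_cdensity.
Qed.

Let Christoffel_scalar j z i : scalar (Christoffel L j z i).
Proof.
move=> a p q; rewrite /Christoffel; case: ifP => _; last exact: L_scalar.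
by rewrite mulrDl -scalerAl L_scalar.
Qed.

Lemma normal_transformP n j l A B z : (2 <= n j)%N -> (1 <= n l)%N ->
  normal mu n -> type_I mu n A -> type_I mu (msub n 1 l) B ->
  normal (transform mu j z) (msub n 2 j) <->
  ~~ root (wronskian (A j) (B j)) z.
Proof.
move=> nj2 nl1 /normalP nd hA hB.
rewrite -(wronskian_nondegenerateP L_scalar z nj2 nl1 nd hA hB).
rewrite -(unique_type_IIP _ (Christoffel_scalar j z)) -transform_functional.
by [].
Qed.

End Normality.

Theorem theorem5p5 (R : realType) (r : nat) (hr : (1 <= r)%N)
    (mu : 'I_r -> complex_measure R)
    (hmu : forall i : 'I_r, finite_moments (mu i))
    (j l : 'I_r) (n : 'I_r -> nat)
    (hnj : (2 <= n j)%N) (hnl : (1 <= n l)%N)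
    (normal_n : normal mu n)
    (normal_nj : normal mu (msub n 1 j))
    (normal_nl : normal mu (msub n 1 l))
    (A B : 'I_r -> {poly R[i]})
    (hA : type_I mu n A) (hB : type_I mu (msub n 1 l) B) :
  [set z0 : R[i] | root (wronskian (A j) (B j)) z0] =
  [set z0 : R[i] | ~ normal (transform mu j z0) (msub n 2 j)] /\
  (real_coefs (A j) -> real_coefs (B j) -> real_rooted (A j) ->
   (interlace (A j) (B j) <->
    forall z0 : R, normal (transform mu j z0%:C) (msub n 2 j))).
Proof.
have tP z := normal_transformP hmu z hnj hnl normal_n hA hB.
split.
  apply/seteqP; split=> z /=; first by move=> rz /tP; rewrite rz.
  by move=> nn; apply: contrapT => /negP rz; apply: nn; apply/tP.
move=> cA cB rA.
(* Normality of [n - e_j] makes the degree of [A j] exactly [n j - 1], which is at least 1 and no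
   less than that of [B j], as [interlaceP] requires. *)
have sA : size (A j) = n j.
  apply: (size_type_I _ _ hA) => //; first exact: ltnW.
  exact/(normalP hmu).
have sB : (size (B j) <= size (A j))%N.
  by case: hB => _ sB _ _; rewrite sA (leq_trans (sB j))// msub_le.
apply: (iff_trans (interlaceP cA cB rA _ sB)); first by rewrite sA.
by split=> H x; apply/tP/H.
Qed.
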